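(* Let $G=(V,E)$ be a graph, let $x\in\mathbb{R}$ with $x>-\frac14$ and $x\neq 0$, and let $S$ be a finite multiset of nonnegative integers such that $\lambda_1^{s+2}\neq\lambda_2^{s+2}$ for all $s\in S$, where $\lambda_{1,2}=\frac12\pm\sqrt{\frac14+x}$ are the two roots of $\lambda^2-\lambda-x$. Then \[ I(G_S;x)=\Big(\prod_{s\in S}C_s\Big)^{|V|}\, I(G;x(S)), \] where \[ x(S)+1=\prod_{s\in S}\Big(1+\frac{B_s}{C_s}\Big),\qquad B_k=\frac{x}{\lambda_2-\lambda_1}\big(\lambda_2^{k+1}-\lambda_1^{k+1}\big),\qquad C_k=\frac{1}{\lambda_2-\lambda_1}\big(\lambda_2^{k+2}-\lambda_1^{k+2}\big). \]
   Context: For a graph $H=(W,F)$ and a number $y$, $I(H;y)=\sum_{A\subseteq W,\,A\text{ independent}} y^{|A|}$, where $A$ is independent if no two vertices of $A$ are adjacent. For a finite multiset $S=\{s_1,\dots,s_\ell\}$ of nonnegative integers, the $S$-clone $G_S$ of $G=(V,E)$ is the graph defined as follows: for each vertex $a\in V$ there are $\ell$ vertices $a_1,\dots,a_\ell$ in $G_S$; for each edge $uv\in E$, every vertex $u_i$ is joined to every vertex $v_j$ ($1\le i,j\le \ell$); for each $a\in V$ and each $i$, $1\le i\le\ell$, there are $s_i$ further new vertices $a_{i,1},\dots,a_{i,s_i}$ and edges $a_ia_{i,1},a_{i,1}a_{i,2},\dots,a_{i,s_i-1}a_{i,s_i}$ (a path of length $s_i$ attached at $a_i$); there are no other vertices or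 edges. *)

(* Defs.v *)
From HB Require Import structures.
From mathcomp Require Import all_boot all_order all_algebra.
From mathcomp Require Import reals.
Set Implicit Arguments.
Unset Strict Implicit.
Unset Printing Implicit Defensive.
Import Order.TTheory GRing.Theory Num.Theory.
Local Open Scope ring_scope.

Record graph := Graph {
  vertex :> finType;
  adj : rel vertex;
  adj_sym : symmetric adj;
  adj_irrefl : irreflexive adj }.

Definition independent (H : graph) (A : {set H}) : bool :=
  [forall u in A, forall v in A, ~~ adj u v].

Definition indep_poly (R : realType) (H : graph) (y : R) : R :=
  \sum_(A : {set H} | independent A) y ^+ #|A|.

Section Clone.
Variables (G : graph) (S : seq nat).

(* A finite multiset is given by any listing S = [:: s_1; ...; s_l]; indices  *)
(* are shifted to start at 0. The vertex (a, Tagged _ k) with tag i stands    *)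
(* for a_i when k = 0 and for the path vertex a_{i,k} when 1 <= k <= s_i.     *)
Definition clone_vertex : finType :=
  (vertex G * {i : 'I_(size S) & 'I_(nth 0%N S i).+1})%type.

Definition clone_base (p : clone_vertex) : G := p.1.
Definition clone_copy (p : clone_vertex) : 'I_(size S) := tag p.2.
Definition clone_pos (p : clone_vertex) : nat := tagged p.2.

Definition clone_adj : rel clone_vertex := fun p q =>
  [&& clone_pos p == 0%N, clone_pos q == 0%N
    & adj (clone_base p) (clone_base q)]
  || [&& clone_base p == clone_base q, clone_copy p == clone_copy q
    & (clone_pos q == (clone_pos p).+1) || (clone_pos p == (clone_pos q).+1)].

Lemma clone_adj_sym : symmetric clone_adj.
Proof.
move=> p q; rewrite /clone_adj adj_sym (eq_sym (clone_base p)).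
by rewrite (eq_sym (clone_copy p)) andbCA
  [(clone_pos q == _) || _]orbC.
Qed.

Lemma clone_adj_irrefl : irreflexive clone_adj.
Proof.
by move=> p; rewrite /clone_adj adj_irrefl !andbF !eqxx orbb ltn_eqF.
Qed.

Definition clone : graph := Graph clone_adj_sym clone_adj_irrefl.

End Clone.

Section Coefficients.
Variables (R : realType) (x : R).

Definition lambda1 : R := 1 / 2 + Num.sqrt (1 / 4 + x).
Definition lambda2 : R := 1 / 2 - Num.sqrt (1 / 4 + x).

Definition Bcoef (k : nat) : R :=
  x / (lambda2 - lambda1) * (lambda2 ^+ (k + 1) - lambda1 ^+ (k + 1)).

Definition Ccoef (k : nat) : R :=
  1 / (lambda2 - lambda1) * (lambda2 ^+ (k + 2) - lambda1 ^+ (k + 2)).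

Definition clone_point (S : seq nat) : R :=
  \prod_(s <- S) (1 + Bcoef s / Ccoef s) - 1.

End Coefficients.

(* Main.v *)
(* An independent set of the clone restricts, above each vertex of [G], to an
   independent set of a disjoint union of paths, one for each [s] in [S], and
   the only constraint between different vertices is that those with a selected
   path root form an independent set of [G].  So the sum factors over the
   vertices, each contributing the rooted or the unrooted weight of the paths.
   The weight of the path on [n] vertices is [Ccoef x n], by the recurrence
   [p (n + 2) = p (n + 1) + x * p n]; hence the unrooted weight is
   [q = \prod_s C_s], the total weight is [\prod_s (C_s + B_s)], and the rooted
   weight, their difference, is [q * clone_point x S]. *)
Require Import Defs.
From mathcomp Require Import all_boot all_order all_algebra.
From mathcomp Require Import reals ring lra.
Set Implicit Arguments.
Unset Strict Implicit.
Unset Printing Implicit Defensive.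
Import Order.TTheory GRing.Theory Num.Theory.
Local Open Scope ring_scope.

(** * Sums over subsets of a fibred finite type *)

(** Presents [T] as a disjoint union of the [U i], so that one product formula serves both the pairs
    and the tagged sums that make up the clone vertices. *)
Definition fibration (I T : finType) (U : I -> finType) (h : T -> I)
    (e : forall i, U i -> T) : Prop :=
  [/\ forall i, injective (e i), forall i u, h (e i u) = i
    & forall t, exists u, e (h t) u = t].

Lemma card_fibers (I T : finType) (U : I -> finType) (h : T -> I)
    (e : forall i, U i -> T) (A : {set T}) :
  fibration h e -> #|A| = (\sum_i #|e i @^-1: A|)%N.
Proof.
move=> [e_inj he eh]; rewrite -sum1_card (partition_big h xpredT) //=.
apply: eq_bigr => i _; rewrite sum1dep_card -(card_imset _ (e_inj i)).
apply: eq_card => t; rewrite !inE; apply/andP/imsetP => [[tA /eqP <-]|[u]].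
  by have [u ut] := eh t; exists u; rewrite ?inE ut.
by rewrite inE => uA ->; rewrite uA he eqxx.
Qed.

(** Choosing a subset of [T] amounts to choosing its trace on each fiber freely, so this is
    distributivity. *)
Lemma sum_set_fibers (R : comPzRingType) (I T : finType) (U : I -> finType)
    (h : T -> I) (e : forall i, U i -> T) (F : forall i, {set U i} -> R) :
  fibration h e ->
  \sum_(A : {set T}) \prod_i F i (e i @^-1: A) =
  \prod_i \sum_(B : {set U i}) F i B.
Proof.
move=> [e_inj he eh].
have eK i (B : {set U i}) : e i @^-1: (e i @: B) = B.
  by apply/setP => u; rewrite inE mem_imset.
(* Distributivity needs a common index type for all factors: subsets of [U i] are replaced by their
   images in [T]. *)
transitivity (\prod_i \sum_(B : {set T} | e i @: (e i @^-1: B) == B)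
                F i (e i @^-1: B)); last first.
  apply: eq_bigr => i _.
  rewrite (reindex_onto (fun B : {set U i} => e i @: B)
             (fun B : {set T} => e i @^-1: B)) /=; last by move=> B /eqP.
  by apply: eq_big => [B|B _]; rewrite !eK ?eqxx.
rewrite bigA_distr_big_dep.
(* A set corresponds to the family of its parts in the fibers; a family [f] is glued back by
   consulting, at [t], only the member [f (h t)]. *)
rewrite [RHS](reindex_onto
  (fun A : {set T} => [ffun i => e i @: (e i @^-1: A)])
  (fun f : {ffun I -> {set T}} => [set t | t \in f (h t)])) /=; last first.
  move=> f /familyP fP; apply/ffunP => i; rewrite ffunE.
  have /eqP fi := fP i; rewrite -[RHS]fi.
  suff -> : e i @^-1: [set t | t \in f (h t)] = e i @^-1: f i by [].
  by apply/setP => u; rewrite !inE he.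
apply: eq_big => [A|A _]; last by apply: eq_bigr => i _; rewrite ffunE eK.
symmetry; apply/andP; split.
  by apply/familyP => i; rewrite ffunE unfold_in /= eK.
apply/eqP/setP => t; rewrite inE ffunE.
by have [u <-] := eh t; rewrite he mem_imset // inE.
Qed.

Lemma sum_set_fibers_card (R : comPzRingType) (I T : finType)
    (U : I -> finType) (h : T -> I) (e : forall i, U i -> T)
    (P : forall i, pred {set U i}) (x : R) :
  fibration h e ->
  \sum_(A : {set T} | [forall i, P i (e i @^-1: A)]) x ^+ #|A| =
  \prod_i \sum_(B : {set U i} | P i B) x ^+ #|B|.
Proof.
move=> fib; under [RHS]eq_bigr => i _ do rewrite big_mkcond /=.
rewrite -(sum_set_fibers _ fib) big_mkcond; apply: eq_bigr => A _.
case: ifPn => [/forallP PA|].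
  rewrite (card_fibers _ fib) -prodrXr.
  by apply: eq_bigr => i _; rewrite PA.
by rewrite negb_forall => /existsP[i /negPf Pi]; rewrite (bigD1 i) //= Pi mul0r.
Qed.

Lemma fibration_pair (I J : finType) :
  fibration (U := fun=> J) (fst : I * J -> I) (fun i j => (i, j)).
Proof. by split=> [i j k []|//|[i j]] //; exists j. Qed.

Lemma fibration_Tagged (I : finType) (U : I -> finType) :
  fibration (U := U) (tag : {i : I & U i} -> I) (fun i u => Tagged U u).
Proof.
split=> [i u v /eqP|//|[i u]]; last by exists u.
by rewrite eq_Tagged => /eqP.
Qed.

(** * Independent sets of a path *)

Lemma ord0_notin_lift n (C : {set 'I_n}) : ord0 \notin lift ord0 @: C.
Proof. by apply/imsetP => -[i _ /eqP]; rewrite (negPf (neq_lift _ _)). Qed.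

Lemma sum_set_ordS (R : nmodType) n (F : {set 'I_n.+1} -> R) :
  \sum_(B : {set 'I_n.+1}) F B =
  \sum_(C : {set 'I_n}) F (lift ord0 @: C)
  + \sum_(C : {set 'I_n}) F (ord0 |: lift ord0 @: C).
Proof.
have K (C : {set 'I_n}) : lift ord0 @^-1: (lift ord0 @: C) = C.
  by apply/setP => u; rewrite inE mem_imset //; apply: lift_inj.
have K0 (C : {set 'I_n}) : lift ord0 @^-1: (ord0 |: lift ord0 @: C) = C.
  apply/setP => u; rewrite !inE mem_imset; last exact: lift_inj.
  by rewrite eq_sym (negPf (neq_lift _ _)).
rewrite (bigID (fun B : {set 'I_n.+1} => ord0 \notin B)) /=; congr (_ + _).
  rewrite (reindex_onto (fun C : {set 'I_n} => lift ord0 @: C)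
     (fun B : {set 'I_n.+1} => lift ord0 @^-1: B)) /=.
    by apply: eq_bigl => C; rewrite ord0_notin_lift K eqxx.
  move=> B B0; apply/setP => u; case: (unliftP ord0 u) => [j|] ->.
    by rewrite mem_imset ?inE //; apply: lift_inj.
  by rewrite (negPf (ord0_notin_lift _)) (negPf B0).
rewrite (reindex_onto (fun C : {set 'I_n} => ord0 |: lift ord0 @: C)
   (fun B : {set 'I_n.+1} => lift ord0 @^-1: B)) /=.
  by apply: eq_bigl => C; rewrite setU11 K0 eqxx.
move=> B; rewrite negbK => B0; apply/setP => u; rewrite !inE.
case: (unliftP ord0 u) => [j|] ->; last by rewrite eqxx B0.
rewrite eq_sym (negPf (neq_lift _ _)) /= mem_imset ?inE //.
exact: lift_inj.
Qed.

(** The path has [n] vertices, with root [ord0]. The one-sided test suffices because [u] and [v]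
    both range over all of [B]. *)
Definition path_indep n (B : {set 'I_n}) : bool :=
  [forall u in B, forall v in B, v != u.+1 :> nat].

Lemma path_indepP n (B : {set 'I_n}) :
  reflect (forall u v : 'I_n, u \in B -> v \in B -> v <> u.+1 :> nat)
          (path_indep B).
Proof.
apply: (iffP forall_inP) => [H u v uB vB|H u uB].
  by apply/eqP; apply: (forall_inP (H u uB)).
by apply/forall_inP => v vB; apply/eqP; apply: H.
Qed.

Lemma path_indep_lift n (C : {set 'I_n}) :
  path_indep (lift ord0 @: C) = path_indep C.
Proof.
apply/path_indepP/path_indepP => [H u v uC vC vu|H u v].
  apply: (H _ _ (imset_f (lift ord0) uC) (imset_f (lift ord0) vC)).
  by rewrite !lift0 vu.
move=> /imsetP[i iC ->] /imsetP[j jC ->]; rewrite !lift0 => -[].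
exact: H.
Qed.

(** The root has a single neighbour, which is [ord0] of the path left after removing the root. *)
Lemma path_indep_ord0U n (C : {set 'I_n.+1}) :
  path_indep (ord0 |: lift ord0 @: C) = path_indep C && (ord0 \notin C).
Proof.
apply/path_indepP/andP => [H|[/path_indepP H C0] u v].
  split.
    apply/path_indepP => u v uC vC vu.
    apply: (H (lift ord0 u) (lift ord0 v)); last by rewrite !lift0 vu.
      by rewrite setU1r ?imset_f.
    by rewrite setU1r ?imset_f.
  apply/negP => C0; apply: (H ord0 (lift ord0 ord0)) => //.
    by rewrite setU11.
  by rewrite setU1r ?imset_f.
case/setU1P => [->|/imsetP[i iC ->]]; case/setU1P => [->|/imsetP[j jC ->]] //.
- rewrite lift0 => -[j0]; move: C0; suff -> : ord0 = j by rewrite jC.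
  exact/val_inj.
- by rewrite !lift0 => -[]; apply: H.
Qed.

Definition path_sum (R : comPzRingType) (x : R) n : R :=
  \sum_(B : {set 'I_n} | path_indep B) x ^+ #|B|.

Lemma path_sum_unrooted (R : comPzRingType) (x : R) n :
  \sum_(B : {set 'I_n.+1} | path_indep B && (ord0 \notin B)) x ^+ #|B| =
  path_sum x n.
Proof.
rewrite big_mkcond sum_set_ordS [X in _ + X]big1 ?addr0; last first.
  by move=> C _; rewrite setU11 andbF.
rewrite /path_sum [RHS]big_mkcond; apply: eq_bigr => C _.
rewrite path_indep_lift ord0_notin_lift andbT card_imset //; exact: lift_inj.
Qed.

Lemma card_ord0U n (C : {set 'I_n}) : #|ord0 |: lift ord0 @: C| = #|C|.+1.
Proof.
by rewrite cardsU1 ord0_notin_lift card_imset //; exact: lift_inj.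
Qed.

Lemma sum_set_ord0 (R : nmodType) (F : {set 'I_0} -> R) :
  \sum_(B : {set 'I_0}) F B = F set0.
Proof.
rewrite (big_pred1 set0) // => B /=; symmetry; apply/eqP.
by apply/setP => -[].
Qed.

Lemma path_sum0 (R : comPzRingType) (x : R) : path_sum x 0 = 1.
Proof.
rewrite /path_sum big_mkcond sum_set_ord0 cards0.
by have -> : path_indep (set0 : {set 'I_0}) by apply/path_indepP => -[].
Qed.

Lemma path_sum1 (R : comPzRingType) (x : R) : path_sum x 1 = 1 + x.
Proof.
have pi1 (B : {set 'I_1}) : path_indep B.
  by apply/path_indepP => u v _ _; rewrite (ord1 v).
rewrite /path_sum big_mkcond sum_set_ordS !sum_set_ord0 !pi1 card_ord0U.
by rewrite imset0 !cards0 expr1 expr0.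
Qed.

(** Split on the root: if absent, a path on [n.+1] vertices remains; if present, it contributes [x]
    and forbids its neighbour, which leaves the unrooted sets of that path. *)
Lemma path_sum_rec (R : comPzRingType) (x : R) n :
  path_sum x n.+2 = path_sum x n.+1 + x * path_sum x n.
Proof.
rewrite {1}/path_sum big_mkcond sum_set_ordS; congr (_ + _).
  rewrite /path_sum [RHS]big_mkcond; apply: eq_bigr => C _.
  rewrite path_indep_lift card_imset //; exact: lift_inj.
rewrite -path_sum_unrooted mulr_sumr [RHS]big_mkcond; apply: eq_bigr => C _.
by rewrite path_indep_ord0U card_ord0U exprS.
Qed.

(** * The closed forms [Bcoef] and [Ccoef] *)

Lemma lambda_neq (R : realType) (x : R) :
  - (1 / 4) < x -> lambda2 x - lambda1 x != 0.
Proof.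
move=> hx; have : 0 < Num.sqrt (1 / 4 + x) by rewrite sqrtr_gt0; lra.
by rewrite /lambda1 /lambda2 => s0; rewrite lt_eqF //; lra.
Qed.

Lemma lambda_sqr (R : realType) (x : R) : - (1 / 4) < x ->
  lambda1 x ^+ 2 = lambda1 x + x /\ lambda2 x ^+ 2 = lambda2 x + x.
Proof.
move=> hx; have s2 : Num.sqrt (1 / 4 + x) ^+ 2 = 1 / 4 + x.
  by rewrite sqr_sqrtr //; lra.
by rewrite /lambda1 /lambda2 sqrrD sqrrB s2; split; field.
Qed.

(** Multiply [l ^+ 2 = l + x] by [l ^+ (k + 1)] for each root [l] and take the difference. *)
Lemma Ccoef_rec (R : realType) (x : R) k : - (1 / 4) < x ->
  Ccoef x k.+1 = Ccoef x k + Bcoef x k.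
Proof.
move=> hx; have [e1 e2] := lambda_sqr hx.
have rec (l : R) : l ^+ 2 = l + x ->
    l ^+ (k.+1 + 2) = l ^+ (k + 2) + x * l ^+ (k + 1).
  move=> e; rewrite !exprD exprS e expr1.
  suff -> : l * l ^+ k * (l + x) = l ^+ k * (l ^+ 2 + x * l) by rewrite e; ring.
  by ring.
by rewrite /Ccoef /Bcoef (rec _ e1) (rec _ e2); ring.
Qed.

Lemma Bcoef_rec (R : realType) (x : R) k : Bcoef x k.+1 = x * Ccoef x k.
Proof. by rewrite /Bcoef /Ccoef addSnnS; ring. Qed.

Lemma path_sum_Ccoef (R : realType) (x : R) k :
  - (1 / 4) < x -> path_sum x k = Ccoef x k.
Proof.
move=> hx; have l0 := lambda_neq hx; have [e1 e2] := lambda_sqr hx.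
have C0 : Ccoef x 0 = 1.
  rewrite /Ccoef !add0n e1 e2.
  have -> : lambda2 x + x - (lambda1 x + x) = lambda2 x - lambda1 x by ring.
  by rewrite mulrAC mul1r mulfV.
have B0 : Bcoef x 0 = x by rewrite /Bcoef !add0n !expr1 divfK.
(* The recurrence has order two, so the induction carries two consecutive values. *)
suff [] : path_sum x k = Ccoef x k /\ path_sum x k.+1 = Ccoef x k.+1 by [].
elim: k => [|k [IH0 IH1]]; first by
  rewrite path_sum0 path_sum1 Ccoef_rec // C0 B0.
by split=> //; rewrite path_sum_rec IH0 IH1 [RHS]Ccoef_rec // Bcoef_rec.
Qed.

(** * Independent sets of the clone *)

Section CloneSum.
Variables (G : graph) (S : seq nat).

Local Notation legs := {i : 'I_(size S) & 'I_(nth 0%N S i).+1}.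

Definition leg (i : 'I_(size S)) (B : {set legs}) : {set 'I_(nth 0%N S i).+1} :=
  (fun k => Tagged (fun i : 'I_(size S) => 'I_(nth 0%N S i).+1) k) @^-1: B.

Definition legs_indep (B : {set legs}) : bool :=
  [forall i, path_indep (leg i B)].

(** On leg [i], [ord0] is the copy $a_i$ itself, the only vertex of the leg that edges coming from
    [G] can reach. *)
Definition rooted (B : {set legs}) : bool := [exists i, ord0 \in leg i B].

Definition fiber (a : G) (A : {set clone G S}) : {set legs} :=
  (fun t => (a, t)) @^-1: A.

(** An edge of [G] joins every copy of one end to every copy of the other, so across fibers it only
    matters whether some root is selected; all other edges stay within one leg. *)
Lemma independent_clone (A : {set clone G S}) :
  independent A =
  [forall a, legs_indep (fiber a A)] && independent [set a | rooted (fiber a A)].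
Proof.
apply/forall_inP/andP => [H|[/forallP Hl /forall_inP Hr] u uA].
  have {}H u v : u \in A -> v \in A -> ~~ clone_adj u v.
    by move=> uA; apply: (forall_inP (H u uA)).
  split.
    apply/forallP => a; apply/forallP => i; apply/path_indepP => k l.
    rewrite !inE => kA lA lk; have /negP := H _ _ kA lA; apply.
    by rewrite /clone_adj /clone_base /clone_copy /clone_pos /= lk !eqxx orbT.
  apply/forall_inP => a; rewrite inE => /existsP[i]; rewrite !inE => aA.
  apply/forall_inP => b; rewrite inE => /existsP[j]; rewrite !inE => bA.
  by apply: contra (H _ _ aA bA); rewrite /clone_adj /= => ->.
apply/forall_inP => v vA; apply/negP => /orP[/and3P[u0 v0]|/and3P[]].
  apply/negP; move: u v u0 v0 uA vA => [a [i k]] [b [j l]].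
  rewrite /clone_pos /= => k0 l0 uA vA.
  apply: (forall_inP (Hr a _)); rewrite inE; apply/existsP.
    by exists i; rewrite !inE (_ : ord0 = k) //; apply/val_inj/esym/eqP.
  by exists j; rewrite !inE (_ : ord0 = l) //; apply/val_inj/esym/eqP.
move: u v uA vA => [a [i k]] [b [j l]].
rewrite /clone_pos /clone_base /clone_copy /=.
(* Base and copy agree, so both vertices lie on one leg, where the path condition excludes either
   order of succession. *)
move=> uA vA /eqP ab /eqP ij; move: b j ab ij l vA => _ _ <- <- l vA.
have /forallP/(_ i)/path_indepP H := Hl a.
by case/orP => /eqP; apply: H; rewrite !inE.
Qed.

Variables (R : realType) (x : R).

(** The leg for [s] has [s.+1] vertices, since it includes its root. *)
Lemma legs_indep_sum :
  \sum_(B | legs_indep B) x ^+ #|B| = \prod_(s <- S) path_sum x s.+1.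
Proof.
rewrite (big_nth 0%N) big_mkord.
exact: (sum_set_fibers_card (fun i => @path_indep _) x (fibration_Tagged _)).
Qed.

Lemma legs_unrooted_sum :
  \sum_(B | legs_indep B && ~~ rooted B) x ^+ #|B| =
  \prod_(s <- S) path_sum x s.
Proof.
rewrite (big_nth 0%N) big_mkord.
under [RHS]eq_bigr => i _ do rewrite -path_sum_unrooted.
rewrite -(sum_set_fibers_card _ x (fibration_Tagged _)).
apply: eq_bigl => B; rewrite negb_exists.
apply/andP/forallP => [[/forallP H1 /forallP H2] i|H].
  by apply/andP; split; [exact: H1|exact: H2].
by split; apply/forallP => i; have /andP[] := H i.
Qed.

(** Group the sets by the set [D] of base vertices with a rooted fiber; once [D] is fixed, the
    fibers are chosen independently. *)
Lemma indep_poly_clone :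
  indep_poly (clone G S) x =
  \sum_(D : {set G} | independent D)
    \prod_a \sum_(B | legs_indep B && (rooted B == (a \in D))) x ^+ #|B|.
Proof.
rewrite /indep_poly (partition_big
  (fun A : {set clone G S} => [set a | rooted (fiber a A)])
  (@independent G)) /=; last by move=> A; rewrite independent_clone => /andP[].
apply: eq_bigr => D iD.
rewrite -(sum_set_fibers_card _ x (fibration_pair _ _)).
apply: eq_bigl => A; rewrite independent_clone.
apply/andP/forallP => [[/andP[/forallP HA _] /eqP <-] a|H].
  by rewrite HA /= inE eqxx.
have AD : [set a | rooted (fiber a A)] = D.
  by apply/setP => a; rewrite inE; have /andP[_ /eqP] := H a.
by rewrite AD iD eqxx andbT; split=> //; apply/forallP => a; have /andP[] := H a.
Qed.

End CloneSum.

Theorem theorem3p5 (R : realType) (G : graph) (x : R) (S : seq nat)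
    (hx : - (1 / 4) < x) (hx0 : x <> 0)
    (hS : forall s : nat, s \in S -> lambda1 x ^+ (s + 2) <> lambda2 x ^+ (s + 2)) :
  indep_poly (clone G S) x =
    (\prod_(s <- S) Ccoef x s) ^+ #|G| * indep_poly G (clone_point x S).
Proof.
(* This is where [hS] enters: it allows division by [Ccoef x s]. *)
have C_neq0 s : s \in S -> Ccoef x s != 0.
  move=> /hS /eqP ls; rewrite /Ccoef mulf_neq0 ?mul1r ?invr_eq0 ?lambda_neq //.
  by rewrite subr_eq0 eq_sym.
set q := \prod_(s <- S) Ccoef x s.
have unrootedE : \sum_(B | legs_indep B && ~~ rooted (S := S) B) x ^+ #|B| = q.
  by rewrite legs_unrooted_sum; apply: eq_bigr => s _; apply: path_sum_Ccoef.
have rootedE : \sum_(B | legs_indep B && rooted (S := S) B) x ^+ #|B| =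
    q * clone_point x S.
  (* Adding the unrooted weight [q] turns the left side into the total weight, which factors over
     [S], and the right side into the product of the [Ccoef x s * (1 + Bcoef x s / Ccoef x s)]. *)
  apply: (addIr q); rewrite -{1}unrootedE -bigID legs_indep_sum.
  rewrite /clone_point mulrBr mulr1 subrK -big_split /=.
  rewrite !big_seq; apply: eq_bigr => s sS.
  by rewrite path_sum_Ccoef // Ccoef_rec // mulrDr mulr1 mulrC divfK ?C_neq0.
rewrite indep_poly_clone /indep_poly mulr_sumr; apply: eq_bigr => D _.
(* Both powers become products over vertices, to be compared factor by factor: [q * clone_point x S]
   inside [D], [q] outside. *)
rewrite -[q ^+ _]prodr_const -[clone_point x S ^+ _]prodr_const.
rewrite [X in _ * X]big_mkcond -big_split /=; apply: eq_bigr => a _.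
case: ifP => _; rewrite ?mulr1.
  by rewrite -rootedE; apply: eq_bigl => B; rewrite eqb_id.
by rewrite -unrootedE; apply: eq_bigl => B; rewrite eqbF_neg.
Qed.
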